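(* There is an absolute constant $c>0$ such that the following holds. Let $G$ be any connected edge-weighted graph of treewidth $t$ with $n$ vertices, and let $\varepsilon\in(0,1)$. Then the shortest-path metric of $G$ admits a $(1+\varepsilon)$-tree cover using at most $2^{(t/\varepsilon)^{c t}}$ trees (in particular, the number of trees does not depend on $n$).
   Context: A dominating tree of a metric space $(X,\delta_X)$ is an edge-weighted tree $T$ with $X\subseteq V(T)$ such that $d_T(x,y)\ge \delta_X(x,y)$ for all $x,y\in X$, where $d_T$ is the shortest-path distance in $T$. For $\alpha\ge1$, an $\alpha$-tree cover of $(X,\delta_X)$ is a collection $\mathcal{F}$ of dominating trees such that for every $x\ne y$ in $X$ there is $T\in\mathcal{F}$ with $d_T(x,y)\le \alpha\cdot\delta_X(x,y)$. Its size is the number of trees. *)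

(* Defs.v *)
From HB Require Import structures.
From mathcomp Require Import all_boot all_order all_algebra.
From mathcomp Require Import classical_sets reals exp.
Set Implicit Arguments. Unset Strict Implicit. Unset Printing Implicit Defensive.
Import Order.TTheory GRing.Theory Num.Theory.
Local Open Scope ring_scope.

Section Graphs.
Variable R : realType.

Fixpoint walk_len (V : Type) (w : V -> V -> R) (x : V) (p : seq V) : R :=
  match p with
  | [::] => 0
  | y :: q => w x y + walk_len w y q
  end.

Definition sp_dist (V : finType) (e : rel V) (w : V -> V -> R) (x y : V) : R :=
  inf [set l : R | exists p : seq V,
         [/\ path e x p, last x p = y & l = walk_len w x p]].

Definition weighted_graph (V : finType) (e : rel V) (w : V -> V -> R) : Prop :=
  [/\ symmetric e, irreflexive e &
      forall x y, e x y -> w x y = w y x /\ 0 < w x y].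

Definition connected_graph (V : finType) (e : rel V) : Prop :=
  forall x y, connect e x y.

Definition is_tree (U : finType) (e : rel U) : Prop :=
  [/\ symmetric e, irreflexive e, connected_graph e &
      ~ exists c : seq U, [/\ (3 <= size c)%N, uniq c & cycle e c]].

Record wtree (V : Type) := WTree {
  wt_type : finType;
  wt_rel : rel wt_type;
  wt_w : wt_type -> wt_type -> R;
  wt_emb : V -> wt_type }.
Arguments wt_type {V} w.
Arguments wt_rel {V} w.
Arguments wt_w {V} w.
Arguments wt_emb {V} w.

Definition dominating_tree (V : finType) (delta : V -> V -> R) (T : wtree V) :=
  [/\ is_tree (wt_rel T), weighted_graph (wt_rel T) (wt_w T),
      injective (wt_emb T) &
      forall x y, delta x y <= sp_dist (wt_rel T) (wt_w T) (wt_emb T x) (wt_emb T y)].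

Definition tree_cover (V : finType) (delta : V -> V -> R) (alpha : R)
    (k : nat) (F : 'I_k -> wtree V) : Prop :=
  (forall i, dominating_tree delta (F i)) /\
  forall x y : V, x != y -> exists i : 'I_k,
    sp_dist (wt_rel (F i)) (wt_w (F i)) (wt_emb (F i) x) (wt_emb (F i) y)
      <= alpha * delta x y.

End Graphs.

Definition tree_decomposition (V : finType) (e : rel V)
    (B : finType) (eB : rel B) (bag : B -> {set V}) : Prop :=
  [/\ is_tree eB,
      forall v, exists b, v \in bag b,
      forall x y, e x y -> exists b, (x \in bag b) && (y \in bag b) &
      forall v b1 b2, v \in bag b1 -> v \in bag b2 ->
        exists p : seq B, [/\ path eB b1 p, last b1 p = b2 &
                              all (fun b => v \in bag b) p]].

Definition decomp_width (V B : finType) (bag : B -> {set V}) : nat :=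
  (\max_(b : B) #|bag b|).-1.

Definition treewidth (V : finType) (e : rel V) (t : nat) : Prop :=
  (exists (B : finType) (eB : rel B) (bag : B -> {set V}),
      tree_decomposition e eB bag /\ decomp_width bag = t) /\
  (forall (B : finType) (eB : rel B) (bag : B -> {set V}),
      tree_decomposition e eB bag -> (t <= decomp_width bag)%N).

(* Main.v *)
(**
Rank the vertices by the depth of the highest bag containing them in a rooted tree
decomposition.  For every vertex z, the component [branch z] of z among the vertices of
rank at least that of z then has at most t neighbours of smaller rank, [lower z].

At a scale D, every vertex z receives a label, chosen among z and the labels of [lower z],
so as to maximise gam * |labels l minus labels z| - d(l, z).  The label is within t * gam
of z.  Along a walk of length O(D) the score can only afford O(D / gam + t) changes of
label, so a cluster (the vertices reached from a vertex labelled l by a short walk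
through labels of rank at least l) meets only clusters whose label is a bounded-depth
ancestor of l.  Greedy colouring then gives, with a number of colours that does not depend
on the number of vertices, maps f_j of displacement O(D) such that any set joined by short
walks inside it is collapsed by one f_j to a single point near the set.

For a fixed colour and a fixed residue of the scale index modulo q, the maps at the scales
2^(s + q i) are the parent pointers of a tree.  The scales are so far apart that the
pointers below scale D move u and v by at most a small fraction of eps * D; if D/2 <
d(u,v) <= D they thus stay in the ellipse around a shortest path from u to v, and the
ellipse is collapsed to a point that is almost between u and v.

When t <= 1 the graph is itself a tree, and one tree suffices.
*)
Require Import Defs.
From HB Require Import structures.
From mathcomp Require Import all_boot all_order all_algebra.
From mathcomp Require Import boolp classical_sets reals exp.
From mathcomp Require Import fintype finset zify ring lra.
Set Implicit Arguments. Unset Strict Implicit. Unset Printing Implicit Defensive.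
Import Order.TTheory GRing.Theory Num.Theory.
Local Open Scope ring_scope.

(** * Walks and the shortest-path metric *)

Section Walks.
Variables (R : realType) (V : finType) (e : rel V) (w : V -> V -> R).
Hypothesis wg : weighted_graph e w.
Local Notation d := (sp_dist e w).

Definition walk_in (P : pred V) (x y : V) (L : R) : Prop :=
  exists p, [/\ path e x p, last x p = y, all P (x :: p) & walk_len w x p <= L].

Lemma walk_len_cat x p q :
  walk_len w x (p ++ q) = walk_len w x p + walk_len w (last x p) q.
Proof. by elim: p x => [|y p IH] x /=; rewrite ?add0r // IH addrA. Qed.

Lemma walk_len_ge0 x p : path e x p -> 0 <= walk_len w x p.
Proof.
case: wg => _ _ wP; elim: p x => //= y p IH x /andP[/wP[_ /ltW xy] /IH].
exact: addr_ge0.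
Qed.

Lemma walk_in_trans P x y z a b :
  walk_in P x y a -> walk_in P y z b -> walk_in P x z (a + b).
Proof.
move=> [p [ep <- /= /andP[Px Pp] lp]] [q [eq <- /= /andP[_ Pq] lq]].
exists (p ++ q); rewrite cat_path ep eq last_cat /= all_cat walk_len_cat Px Pp Pq.
by split => //; apply: lerD.
Qed.

Lemma walk_in_le (P Q : pred V) x y a b :
  {subset P <= Q} -> a <= b -> walk_in P x y a -> walk_in Q x y b.
Proof.
move=> sPQ ab [p [ep lp Pp wp]]; exists p; split=> //; last exact: le_trans ab.
exact: sub_all sPQ _ Pp.
Qed.

Lemma walk_in_sym P x y a : walk_in P x y a -> walk_in P y x a.
Proof.
move=> [p [ep <- Pp wp]]; apply: (@walk_in_le P P _ _ (walk_len w x p)) => //.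
case: wg => es _ wP {wp}; elim: p x ep Pp => [|z p IH] x /=.
  by move=> _ /andP[Px _]; exists [::]; rewrite /= Px.
move=> /andP[xz ep] /and3P[Px Pz Pp].
rewrite addrC; apply: walk_in_trans (IH _ ep _) _; first by rewrite /= Pz.
exists [:: x]; rewrite /= es xz Px Pz addr0; split=> //.
by have [-> _] := wP _ _ xz.
Qed.

Lemma sp_dist_le x p : path e x p -> d x (last x p) <= walk_len w x p.
Proof.
move=> ep; apply: ge_inf; last by exists p.
by exists 0 => _ [q [eq _ ->]]; apply: walk_len_ge0.
Qed.

Lemma sp_dist_edge x y : e x y -> d x y <= w x y.
Proof.
by move=> exy; rewrite -[w x y]addr0; apply: (sp_dist_le (p := [:: y])); rewrite /= exy.
Qed.

Lemma walk_in_dist P x y a : walk_in P x y a -> d x y <= a.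
Proof. by move=> [p [ep <- _]]; apply: le_trans; apply: sp_dist_le. Qed.

Hypothesis cg : connected_graph e.

Lemma sp_dist_lb x y b :
  (forall p, path e x p -> last x p = y -> b <= walk_len w x p) -> b <= d x y.
Proof.
move=> lb; apply: lb_le_inf; last by move=> _ [p [ep lp ->]]; apply: lb.
by have /connectP[p ep ->] := cg x y; exists (walk_len w x p), p.
Qed.

Lemma sp_dist_ge0 x y : 0 <= d x y.
Proof. by apply: sp_dist_lb => p ep _; apply: walk_len_ge0. Qed.

Lemma near_walk x y eta : 0 < eta ->
  exists p, [/\ path e x p, last x p = y & walk_len w x p < d x y + eta].
Proof.
move=> eta0.
have [|_ [p [ep lp ->]] lt] := @inf_adherent R
  [set l : R | exists p, [/\ path e x p, last x p = y & l = walk_len w x p]]%classic eta eta0.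
  split; first by have /connectP[p ep ->] := cg x y; exists (walk_len w x p), p.
  by exists 0 => _ [q [eq _ ->]]; apply: walk_len_ge0.
by exists p.
Qed.

Lemma sp_dist_triangle y x z : d x z <= d x y + d y z.
Proof.
apply/ler_addgt0Pr => eta eta0.
have [p [ep lp wp]] := @near_walk x y (eta / 2) ltac:(lra).
have [q [eq lq wq]] := @near_walk y z (eta / 2) ltac:(lra).
have ew : path e x (p ++ q) by rewrite cat_path ep lp eq.
have := sp_dist_le ew; rewrite last_cat lp lq walk_len_cat lp; lra.
Qed.

Lemma sp_dist_refl x : d x x = 0.
Proof. by apply/le_anti; rewrite sp_dist_ge0 (@sp_dist_le x [::]). Qed.

Lemma sp_dist_sym x y : d x y = d y x.
Proof.
have le a b : d a b <= d b a.
  apply/ler_addgt0Pr => eta eta0.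
  have [p [ep lp /ltW wp]] := @near_walk b a eta eta0.
  apply/walk_in_dist/(@walk_in_sym predT).
  by exists p; rewrite all_predT.
by apply/le_anti; rewrite !le.
Qed.

(** Cutting a walk that is optimal up to [eta] at any of its vertices bounds the two distances by
    the lengths of the pieces. *)
Lemma near_geodesic x y eta : 0 < eta ->
  walk_in [pred z | d x z + d z y < d x y + eta] x y (d x y + eta).
Proof.
move=> eta0; have [p [ep lp wp]] := @near_walk x y eta eta0.
exists p; split; rewrite ?ltW //.
apply/allP => z; rewrite inE => /predU1P[->|zp] /=.
  by rewrite sp_dist_refl; lra.
move: zp ep lp wp => /splitPr[p1 p2]; rewrite cat_path last_cat /=.
move=> /and3P[ep1 ez ep2] lp; rewrite walk_len_cat /= => wp.
have h1 : path e x (rcons p1 z) by rewrite rcons_path ep1.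
have := sp_dist_le h1; rewrite last_rcons -cats1 walk_len_cat /= addr0 => h2.
have := sp_dist_le ep2; rewrite lp; lra.
Qed.

Lemma sp_dist_gap : exists2 delta, 0 < delta & forall x y, x != y -> delta <= d x y.
Proof.
case: wg => _ _ wP.
have [delta d0 dP] : exists2 delta, 0 < delta & forall xy, e xy.1 xy.2 -> delta <= w xy.1 xy.2.
  (* The default 1 serves a graph without edges. *)
  exists (\big[Num.min/1]_(xy : V * V | e xy.1 xy.2) w xy.1 xy.2).
    elim/big_ind: _ => // [a b a0 b0|i]; first by rewrite lt_min a0.
    by move/wP => [].
  by move=> xy exy; rewrite (bigD1 xy) //= ge_min lexx.
exists delta => // x y xy; apply: sp_dist_lb => -[|z p] /=.
  by move=> _ xE; rewrite xE eqxx in xy.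
move=> /andP[xz ep] _; rewrite (le_trans (dP (x, z) xz)) //= lerDl.
exact: walk_len_ge0.
Qed.

Lemma sp_dist_bounded : exists M, forall x y, d x y <= M.
Proof.
exists (\sum_(xy : V * V) d xy.1 xy.2) => x y; rewrite (bigD1 (x, y)) //= lerDl.
by apply: sumr_ge0 => ? _; apply: sp_dist_ge0.
Qed.

End Walks.

(** * Ranks, branches and their separators *)

Section Elimination.
Variables (V : finType) (e : rel V) (rho : V -> nat).
Hypothesis es : symmetric e.

Definition above (r : nat) : rel V :=
  [rel x y | [&& e x y, (r <= rho x)%N & (r <= rho y)%N]].

Definition branch (z : V) : pred V := connect (above (rho z)) z.

(** For injective [rho] these are the neighbours of smaller rank in the chordal completion obtained
    by eliminating vertices in decreasing order of rank. *)
Definition lower (z : V) : {set V} :=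
  [set s | (rho s < rho z)%N && [exists x, branch z x && e x s]].

Lemma branch_refl z : branch z z.
Proof. exact: connect0. Qed.

Lemma branch_ge z x : branch z x -> (rho z <= rho x)%N.
Proof.
move=> /connectP[p]; elim/last_ind: p => [_ ->|p y _] //.
by rewrite rcons_path last_rcons => /andP[_ /and3P[_ _ h]] ->.
Qed.

Lemma branch_step z x y :
  branch z x -> e x y -> (rho z <= rho y)%N -> branch z y.
Proof.
move=> zx xy zy; apply: connect_trans (zx) (connect1 _).
by rewrite /above /= xy zy (branch_ge zx).
Qed.

Lemma branch_trans z u v : branch u z -> branch z v -> branch u v.
Proof.
move=> uz zv; apply: connect_trans (uz) _; have le := branch_ge uz.
apply: connect_sub zv => a b /and3P[ab za zb].
by apply: connect1; rewrite /above /= ab !(leq_trans le).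
Qed.

Lemma above_sym r : connect_sym (above r).
Proof. by apply: sym_connect_sym => x y; rewrite /above /= es [(r <= rho x)%N && _]andbC. Qed.

Lemma lower_lt s z : s \in lower z -> (rho s < rho z)%N.
Proof. by rewrite inE => /andP[]. Qed.

Lemma lowerI z x s : branch z x -> e x s -> (rho s < rho z)%N -> s \in lower z.
Proof. by move=> zx xs sz; rewrite inE sz; apply/existsP; exists x; rewrite zx. Qed.

Lemma branch_lower s z : s \in lower z -> branch s z.
Proof.
rewrite inE => /andP[sz /existsP[x /andP[zx xs]]].
rewrite /branch above_sym; apply: (@connect_trans _ _ x); last first.
  by apply: connect1; rewrite /above /= xs leqnn (leq_trans (ltnW sz) (branch_ge zx)).
apply: connect_sub zx => a b /and3P[ab za zb].
by apply: connect1; rewrite /above /= ab !(leq_trans (ltnW sz)).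
Qed.

(** The edge by which [s] leaves the branch of [v] starts inside the branch of [u], and either stays
    there or leaves it as well. *)
Lemma lower_branch u v s : branch u v -> s \in lower v ->
  if (rho s < rho u)%N then s \in lower u else branch u s.
Proof.
rewrite inE => uv /andP[sv /existsP[x /andP[vx xs]]]; have ux := branch_trans uv vx.
by case: ltnP => su; [apply: lowerI xs su | apply: branch_step xs su].
Qed.

End Elimination.


(** * The score-maximising labelling at one scale *)

Section Labelling.
Variables (R : realType) (V : finType) (e : rel V) (d : V -> V -> R) (gam : R).
Variables (rho : V -> nat).
Hypothesis es : symmetric e.
Local Notation lower := (lower e rho).
Local Notation branch := (branch e rho).

(* [labels z] is a set of at most t labels that separate the branch of z from the vertices
   of smaller rank, in the sense of [label_branch] and [labels_branch] below. *)
Section Candidates.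
Variable sigma : V -> V.

Definition labels (z : V) : {set V} := sigma @: lower z.

Definition cand (z : V) : {set V} := z |: labels z.

Definition score (z l : V) : R := #|labels l :\: labels z|%:R * gam - d l z.

Definition labelled (z : V) : Prop :=
  sigma z \in cand z /\ forall l, l \in cand z -> score z l <= score z (sigma z).

End Candidates.

Lemma eq_labels n sigma tau z : (forall s, (rho s < n)%N -> sigma s = tau s) ->
  (rho z <= n)%N -> labels sigma z = labels tau z.
Proof.
move=> st zn; apply: eq_in_imset => s /lower_lt sz; apply: st.
exact: leq_trans sz zn.
Qed.

Lemma labelled_le sigma n z :
  (forall s, (rho s < n)%N -> sigma s \in cand sigma s) -> (rho z < n)%N ->
  (rho (sigma z) <= rho z)%N.
Proof.
move=> H; have [m] := ubnP (rho z); elim: m z => // m IH z zm zn.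
have /setU1P[->//|/imsetP[s sN ->]] := H z zn.
have sz := lower_lt sN; apply: leq_trans (ltnW sz); apply: IH; lia.
Qed.

(** The candidates of [z] and their scores involve only labels of vertices of smaller rank, so
    labels can be chosen by recursion on the rank. *)
Lemma labelling_exists : exists sigma, forall z, labelled sigma z.
Proof.
suff st n : exists sigma, forall z, (rho z < n)%N -> labelled sigma z.
  have [sigma sP] := st (\max_z rho z).+1; exists sigma => z; apply: sP.
  by rewrite ltnS (leq_bigmax z).
elim: n => [|n [sigma sP]]; first by exists id.
pose tau z := if (rho z < n)%N then sigma z
  else [arg max_(l > z in cand sigma z) score sigma z l]%O.
have st s : (rho s < n)%N -> tau s = sigma s by rewrite /tau => ->.
have eL z : (rho z <= n)%N -> labels tau z = labels sigma z := eq_labels st.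
have le_n z l : (rho z <= n)%N -> l \in cand sigma z -> (rho l <= n)%N.
  move=> zn /setU1P[->//|/imsetP[s /lower_lt sz ->]].
  have sn := leq_trans sz zn; apply: leq_trans (ltnW sn).
  by apply: (@labelled_le _ n) => // a /sP[].
exists tau => z; rewrite ltnS => zn; rewrite /labelled /cand eL //.
have eS l : l \in cand sigma z -> score tau z l = score sigma z l.
  by move=> lz; rewrite /score !eL // (le_n z).
have tz : tau z \in cand sigma z /\
    forall l, l \in cand sigma z -> score sigma z l <= score sigma z (tau z).
  rewrite /tau; case: ifP => [/sP//|_].
  by case: arg_maxP => [|l lz lP]; rewrite ?setU11.
by case: tz => t1 t2; split=> // l lz; rewrite !eS // t2.
Qed.

Variable sigma : V -> V.
Hypothesis sigmaP : forall z, labelled sigma z.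
Local Notation S := (labels sigma).
Local Notation C := (cand sigma).
Local Notation F := (score sigma).

Lemma label_le z : (rho (sigma z) <= rho z)%N.
Proof. by apply: (@labelled_le _ (rho z).+1) => // s _; case: (sigmaP s). Qed.

Lemma labels_lt s z : s \in S z -> (rho s < rho z)%N.
Proof. by move=> /imsetP[x /lower_lt xz ->]; apply: leq_ltn_trans xz; apply: label_le. Qed.

Lemma branch_label z : branch (sigma z) z.
Proof.
have [m] := ubnP (rho z); elim: m z => // m IH z zm.
have [/setU1P[->|/imsetP[s sN ->]] _] := sigmaP z; first exact: branch_refl.
apply: branch_trans (branch_lower es sN); apply: IH.
have := lower_lt sN; lia.
Qed.

(** Follow the chain of vertices from which [v] inherits its label: it has to leave the branch of
    [u], and does so at a vertex of [lower u]. *)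
Lemma label_branch u v : branch u v -> (rho (sigma v) < rho u)%N -> sigma v \in S u.
Proof.
have [m] := ubnP (rho v); elim: m v => // m IH v vm uv lt.
have [/setU1P[E|/imsetP[s sN E]] _] := sigmaP v.
  by move: lt; rewrite E ltnNge (branch_ge uv).
rewrite E in lt *; have := lower_branch uv sN; case: ifP => [_ su|_ us].
  exact: imset_f.
by apply: IH => //; have := lower_lt sN; lia.
Qed.

Lemma labels_branch u v l :
  branch u v -> l \in S v -> (rho l < rho u)%N -> l \in S u.
Proof.
move=> uv /imsetP[s sN ->]; have := lower_branch uv sN.
by case: ifP => [_ su _|_]; [apply: imset_f | apply: label_branch].
Qed.

Lemma branch_cand l m : l \in C m -> branch l m.
Proof.
move=> /setU1P[->|/imsetP[s sN ->]]; first exact: branch_refl.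
exact: branch_trans (branch_label s) (branch_lower es sN).
Qed.

(** The candidates of a vertex form a chain: [m] lies in the branch of [l], and a label of rank
    below [l] seen from that branch is seen from [l]. *)
Lemma cand_labels k l m : k \in C m -> l \in C m -> (rho k < rho l)%N -> k \in S l.
Proof.
move=> /setU1P[->|km] lm kl; have lm' := branch_cand lm.
  by move: kl; rewrite ltnNge (branch_ge lm').
exact: labels_branch km kl.
Qed.

End Labelling.

(** * Bounded chains of labels, clusters and their colouring *)

Section Chains.
Variables (R : realType) (V : finType) (e : rel V) (w : V -> V -> R).
Hypotheses (wg : weighted_graph e w) (cg : connected_graph e).
Local Notation d := (sp_dist e w).
Variables (rho : V -> nat) (rho_inj : injective rho) (gam : R) (gam0 : 0 < gam).
Variable (t : nat).
Hypothesis lower_card : forall z, (#|lower e rho z| <= t)%N.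
Variable sigma : V -> V.
Hypothesis sigmaP : forall z, labelled e d gam rho sigma z.
Local Notation branch := (branch e rho).
Local Notation S := (labels e rho sigma).
Local Notation C := (cand e rho sigma).
Local Notation F := (score e d gam rho sigma).

Let es : symmetric e. Proof. by case: wg. Qed.

Lemma labels_card z : (#|S z| <= t)%N.
Proof. exact: leq_trans (leq_imset_card _ _) (lower_card z). Qed.

Lemma card_cand z : (#|C z| <= t.+1)%N.
Proof. by rewrite cardsU1 -add1n leq_add ?leq_b1 ?labels_card. Qed.

Lemma score_self z : F z z = 0.
Proof. by rewrite /score setDv cards0 mul0r sp_dist_refl ?subr0. Qed.

(** The candidate [z] scores 0, so the chosen label has a nonnegative score, while its counting term
    is at most [t * gam]. *)
Lemma label_dist z : d (sigma z) z <= t%:R * gam.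
Proof.
have [_ /(_ z (setU11 _ _))] := sigmaP z; rewrite score_self /score.
have : (#|S (sigma z) :\: S z| <= t)%N.
  by apply: leq_trans (labels_card (sigma z)); rewrite subset_leq_card ?subsetDl.
rewrite -(ler_nat R) -(ler_pM2r gam0); lra.
Qed.

Fixpoint ancestors (i : nat) (l : V) : {set V} :=
  if i is j.+1 then \bigcup_(m in ancestors j l) C m else [set l].

Lemma ancestorsS i l k m : m \in ancestors i l -> k \in C m -> k \in ancestors i.+1 l.
Proof. by move=> mi km; apply/bigcupP; exists m. Qed.

Lemma ancestors_mono i j l : (i <= j)%N -> ancestors i l \subset ancestors j l.
Proof.
move=> /subnK <-; elim: (j - i)%N => [|n IH] //; apply: (subset_trans IH).
by apply/subsetP => m mn; apply: ancestorsS mn (setU11 _ _).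
Qed.

Lemma ancestors_refl i l : l \in ancestors i l.
Proof. by apply: (subsetP (ancestors_mono _ (leq0n i))); rewrite inE. Qed.

Lemma ancestors_card i l : (#|ancestors i l| <= t.+1 ^ i)%N.
Proof.
elim: i => [|i IH] /=; first by rewrite cards1.
apply: (@leq_trans (\sum_(m in ancestors i l) t.+1)); last first.
  by rewrite sum_nat_const expnSr leq_mul2r IH orbT.
elim/big_rec2: _ => [|m n A _ le]; first by rewrite cards0.
by rewrite (leq_trans (leq_card_setU _ _)) // leq_add ?card_cand.
Qed.

Section Descent.
Variables k l : V.

(* The state of a walk from a vertex labelled l towards one labelled k < l: u is the vertex
   of least rank so far, D the length walked when it was reached, a the value of D at the
   last change of the tracked label lam, and i the number of changes.  The inequality
   [descent_pot] bounds i. *)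
Record descent (u lam : V) (i : nat) (a D : R) : Prop := Descent {
  descent_cand : lam \in C u;
  descent_anc : lam \in ancestors i l;
  descent_ge : (rho k <= rho lam)%N;
  descent_max : forall mu, mu \in C u -> F u mu <= F u lam + 2 * (D - a);
  descent_pot : #|S lam|%:R * gam - d lam u + i%:R * gam <= t%:R * gam + 2 * a + D;
  descent_a : 0 <= a <= D }.

Lemma cardsDR (A B : {set V}) : #|A :\: B|%:R = #|A|%:R - #|A :&: B|%:R :> R.
Proof. by rewrite -(cardsID B A) natrD addrAC subrr add0r. Qed.

(** Moving from [u] to [u'] changes each distance term by at most [del], which the growth of
    [2 * (D - a)] pays for; the counting terms can only shift in favour of [lam]. *)
Lemma descent_keep u u' lam i a D del :
  descent u lam i a D -> u' \in lower e rho u -> d u u' <= del -> 0 <= del ->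
  (rho lam <= rho (sigma u'))%N -> descent u' lam i a (D + del).
Proof.
move=> [c1 c2 c3 c4 c5 c6] uu duu del0 lam_le.
have bu := branch_lower es uu; have u'u := lower_lt uu.
have su := label_le sigmaP u'; have scu : sigma u' \in C u by rewrite inE imset_f ?orbT.
have tri x : d x u <= d x u' + del.
  by apply: le_trans (sp_dist_triangle wg cg u' _ _) _; rewrite (sp_dist_sym wg cg u' u) lerD2l.
have tri' x : d x u' <= d x u + del.
  by apply: le_trans (sp_dist_triangle wg cg u _ _) _; rewrite lerD2l.
split=> //; last 2 first.
- have := tri lam; lra.
- lra.
- have lamS : lam \in S u.
    case/setU1P: c1 => // E; move: (leq_ltn_trans (leq_trans lam_le su) u'u).
    by rewrite E ltnn.
  have [E|lt] := eqVneq lam (sigma u'); first by rewrite E; case: (sigmaP u').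
  rewrite inE (labels_branch sigmaP bu) ?orbT //.
  apply: leq_trans su; rewrite ltn_neqAle lam_le andbT.
  by apply: contraNneq lt => /rho_inj->.
move=> mu muu; have [sc /(_ _ muu) mu_le] := sigmaP u'.
have [E|lt] := eqVneq lam (sigma u'); first by rewrite E; lra.
have {}lt : (rho lam < rho (sigma u'))%N.
  by rewrite ltn_neqAle lam_le andbT; apply: contraNneq lt => /rho_inj->.
have lamS := cand_labels es sigmaP c1 scu lt.
apply: le_trans mu_le _; have := c4 _ scu.
have t1 := tri lam; have t2 := tri' (sigma u').
(* Every label of [lam] that is shared with [u'] but not with [u] is also such a label of
   [sigma u'], so [sigma u'] loses at least as much as [lam]. *)
suff : #|S (sigma u') :\: S u'|%:R - #|S lam :\: S u'|%:R <=
       #|S (sigma u') :\: S u|%:R - #|S lam :\: S u|%:R :> R.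
  rewrite /score -(ler_pM2r gam0) !mulrBl.
  have := tri (sigma u'); have := tri' lam; lra.
rewrite !cardsDR.
set B := S (sigma u'); set A := S lam.
have sub (X : {set V}) : (forall x, x \in X -> rho x < rho u')%N -> X :&: S u \subset X :&: S u'.
  move=> H; apply/subsetP => x; rewrite !inE => /andP[xX xu]; rewrite xX.
  by apply: labels_branch bu xu _ => //; apply: H.
have sB : B :&: S u \subset B :&: S u'.
  by apply: sub => x /(labels_lt sigmaP) xs; apply: leq_trans xs su.
have sA : A :&: S u \subset A :&: S u'.
  by apply: sub => x /(labels_lt sigmaP) xs; apply: ltn_trans xs (leq_trans lt su).
have sAB : (A :&: S u') :\: (A :&: S u) \subset (B :&: S u') :\: (B :&: S u).
  apply/subsetP => x; rewrite !inE => /andP[nu /andP[xA xu']].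
  have xu : x \notin S u by apply: contra nu => ->; rewrite xA.
  rewrite (negPf xu) andbF xu' andbT.
  apply: (cand_labels es sigmaP _ sc); first by rewrite inE xu' orbT.
  exact: ltn_trans (labels_lt sigmaP xA) lt.
have := subset_leq_card sAB; rewrite !cardsDS // -(ler_nat R) !natrB ?subset_leq_card //.
lra.
Qed.

(** The switch gains a full [gam]: [sigma u'] itself lies in [S lam :&: S u] but not in
    [S (sigma u')]. Near-maximality of [lam] at [u] then carries the potential over to the new
    label. *)
Lemma descent_switch u u' lam i a D del :
  descent u lam i a D -> u' \in lower e rho u -> d u u' <= del -> 0 <= del ->
  (rho (sigma u') < rho lam)%N -> (rho k <= rho (sigma u'))%N ->
  descent u' (sigma u') i.+1 (D + del) (D + del).
Proof.
move=> [c1 c2 c3 c4 c5 c6] uu duu del0 lt ku.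
have scu : sigma u' \in C u by rewrite inE imset_f ?orbT.
have sl : sigma u' \in S lam by apply: cand_labels scu c1 lt.
have [sc sm] := sigmaP u'.
split=> //; last by lra.
- by apply: ancestorsS c2 _; rewrite inE sl orbT.
- by move=> mu /sm; lra.
have := c4 _ scu; rewrite /score !cardsDR.
have : (#|S (sigma u') :&: S u| < #|S lam :&: S u|)%N.
  apply/proper_card/properP; split.
    apply/subsetP => x; rewrite !inE => /andP[xs xu]; rewrite xu andbT.
    apply: (cand_labels es sigmaP _ c1); first by rewrite inE xu orbT.
    exact: ltn_trans (labels_lt sigmaP xs) lt.
  exists (sigma u'); first by rewrite inE sl imset_f.
  by apply/negP => /setIP[/(labels_lt sigmaP)]; rewrite ltnn.
rewrite -(ler_nat R) -(ler_pM2r gam0) -[_.+1]addn1 natrD !mulrDl.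
rewrite -[i.+1]addn1 natrD !mulrDl !mulNr !mul1r.
have := sp_dist_triangle wg cg u (sigma u') u'.
have := sp_dist_triangle wg cg u' (sigma u') u.
rewrite (sp_dist_sym wg cg u' u); lra.
Qed.

(** Only vertices of rank below [u] change the state; [ell] bounds the distance walked since [u], to
    be charged to [D] at the next such vertex. *)
Lemma descent_walk p u v lam i a D ell :
  descent u lam i a D -> branch u v -> d u v <= ell -> path e v p ->
  all (fun z => rho k <= rho (sigma z))%N p ->
  exists u' lam' i' a' D', [/\ descent u' lam' i' a' D', branch u' (last v p) &
    D' <= D + ell + walk_len w v p].
Proof.
elim: p u v lam i a D ell => [|v' p IH] u v lam i a D ell I uv duv /=.
  move=> _ _; exists u, lam, i, a, D; split=> //.
  have := sp_dist_ge0 wg cg u v; lra.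
move=> /andP[vv ep] /andP[kv kp]; have wv := sp_dist_edge wg vv.
have duv' : d u v' <= ell + w v v'.
  by have := sp_dist_triangle wg cg v u v'; lra.
have [le|lt] := leqP (rho u) (rho v').
  have [u1 [l1 [i1 [a1 [D1 [I1 b1 le1]]]]]] :=
    IH u v' lam i a D (ell + w v v') I (branch_step uv vv le) duv' ep kp.
  by exists u1, l1, i1, a1, D1; split=> //; lra.
have vu := lowerI uv vv lt.
have del0 : 0 <= ell + w v v' by apply: le_trans duv'; apply: sp_dist_ge0.
have [lam1 [i1 [a1 I1]]] :
  exists lam1 i1 a1, descent v' lam1 i1 a1 (D + (ell + w v v')).
  have [h|h] := leqP (rho lam) (rho (sigma v')).
    by exists lam, i, a; apply: descent_keep I vu _ _ h.
  by exists (sigma v'), i.+1, (D + (ell + w v v')); apply: descent_switch I vu _ _ h kv.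
have dvv : d v' v' <= 0 by rewrite sp_dist_refl.
have [u2 [l2 [i2 [a2 [D2 [I2 b2 le2]]]]]] :=
  IH v' v' _ _ _ _ 0 I1 (branch_refl _ _ _) dvv ep kp.
by exists u2, l2, i2, a2, D2; split=> //; lra.
Qed.

End Descent.

Variables (K : nat) (H : R).
Hypotheses (H0 : 0 <= H) (HK : 6 * H <= K%:R * gam).

Definition cluster (l z : V) : Prop := exists2 x, sigma x = l &
  walk_in e w [pred y | rho l <= rho (sigma y)]%N x z H.

Lemma cluster_ancestors k l z : cluster k z -> cluster l z ->
  (rho k < rho l)%N -> k \in ancestors (t + K).+1 l.
Proof.
move=> [x xk wx] [y yl wy] kl.
have sub (Q : pred V) : (forall a, Q a -> rho l <= rho (sigma a))%N ->
    {subset Q <= [pred a | rho k <= rho (sigma a)]%N}.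
  by move=> QP a /QP la; rewrite inE; apply: leq_trans la; apply: ltnW.
have := walk_in_trans (walk_in_le (sub _ (fun _ => id)) (lexx H) wy) (walk_in_sym wg wx).
move=> [p [ep lp /= /andP[_ ap] wp]].
have I0 : descent k l y l 0 0 0.
  have [sc sm] := sigmaP y; rewrite yl in sc sm; split=> //.
  - exact: ancestors_refl.
  - exact: ltnW.
  - by move=> mu /sm; lra.
  - have := labels_card l; rewrite -(ler_nat R) -(ler_pM2r gam0).
    have := sp_dist_ge0 wg cg l y; lra.
  - by rewrite lexx.
have dyy : d y y <= 0 by rewrite sp_dist_refl.
have [u [lam [i [a [D [I ux DH]]]]]] := descent_walk I0 (branch_refl _ _ _) dyy ep ap.
rewrite lp in ux; case: I => c1 c2 c3 c4 c5 c6.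
(* Comparing [lam] with the candidate [u], of score 0, bounds the potential from below and leaves
   [i * gam <= t * gam + 3 * D]. Since [D <= 2 * H], this is where the 6 in [HK] comes from. *)
have it : (i <= t + K)%N.
  have := c4 u (setU11 _ _); rewrite score_self /score cardsDR => c4u.
  rewrite -(ler_nat R) natrD -(ler_pM2r gam0) mulrDl.
  move: c4u; rewrite mulrBl.
  have : 0 <= #|S lam :&: S u|%:R * gam by rewrite mulr_ge0 // ltW.
  have DH' : D <= H + H by rewrite !add0r in DH; apply: le_trans wp.
  have := HK; lra.
have lam_anc : lam \in ancestors (t + K) l by apply: (subsetP (ancestors_mono _ it)).
(* The final label [k] is [lam] or a label seen from [lam], at the price of one more generation. *)
apply: ancestorsS lam_anc _.
have bu := branch_cand es sigmaP c1.
have [xu|ux'] := ltnP (rho k) (rho u).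
  have kS : k \in C u by rewrite -xk inE (label_branch sigmaP) ?orbT // xk.
  have [E|ne] := eqVneq k lam; first by rewrite E setU11.
  rewrite inE (cand_labels es sigmaP kS c1) ?orbT // ltn_neqAle c3 andbT.
  by apply: contraNneq ne => /rho_inj->.
have E : k = lam.
  by apply/rho_inj/anti_leq; rewrite c3 (leq_trans (branch_ge bu)).
by rewrite E setU11.
Qed.

Lemma cluster_colouring : exists c : V -> 'I_(t.+1 ^ (t + K).+1),
  forall k l z, cluster k z -> cluster l z -> c k = c l -> k = l.
Proof.
set N := (_ ^ _)%N.
suff [c cP] : exists c : V -> 'I_N, forall l k,
    k \in ancestors (t + K).+1 l -> (rho k < rho l)%N -> c k != c l.
  exists c => k l z kz lz E.
  have [kl|lk|/rho_inj//] := ltngtP (rho k) (rho l).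
    by have := cP _ _ (cluster_ancestors kz lz kl) kl; rewrite E eqxx.
  by have := cP _ _ (cluster_ancestors lz kz lk) lk; rewrite E eqxx.
have N0 : (0 < N)%N by rewrite expn_gt0.
suff st n : exists c : V -> 'I_N, forall l k, (rho l < n)%N ->
    k \in ancestors (t + K).+1 l -> (rho k < rho l)%N -> c k != c l.
  have [c cP] := st (\max_z rho z).+1; exists c => l k; apply: cP.
  by rewrite ltnS (leq_bigmax l).
elim: n => [|n [c cP]]; first by exists (fun=> Ordinal N0).
have [l ln|no] := pickP [pred l | rho l == n]; last first.
  exists c => l k; rewrite ltnS leq_eqVlt => /predU1P[ln|]; last exact: cP.
  by have := no l; rewrite /= ln eqxx.
have {}ln : rho l = n := eqP ln.
have [j jP] : exists j, j \notin c @: (ancestors (t + K).+1 l :\ l).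
  apply/existsP; rewrite -negb_forall; apply/negP => /forallP full.
  (* There are at most [N] ancestors counting [l] itself, so fewer than [N] colours are
     forbidden. *)
  have : (#|c @: (ancestors (t + K).+1 l :\ l)| < N)%N.
    apply: leq_ltn_trans (leq_imset_card _ _) _.
    have := ancestors_card (t + K).+1 l.
    by rewrite (cardsD1 l) ancestors_refl.
  suff -> : c @: (ancestors (t + K).+1 l :\ l) = setT by rewrite cardsT card_ord ltnn.
  by apply/setP => j; rewrite inE full.
exists (fun v => if v == l then j else c v) => m k mn km lt.
have [E|kl] := eqVneq k l.
  by move: lt; rewrite E ln ltnNge -ltnS mn.
have [E|ml] := eqVneq m l.
  by apply: contraNneq jP => <-; rewrite imset_f // !inE kl -E.
apply: cP => //; rewrite ltn_neqAle -ltnS mn andbT.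
by rewrite -ln; apply: contraNneq ml => /rho_inj->.
Qed.

Lemma single_scale : exists f : 'I_(t.+1 ^ (t + K).+1) -> V -> V,
  (forall j z, d z (f j z) <= H + t%:R * gam) /\
  forall (P : pred V) (x0 : V), P x0 ->
    (forall x y, P x -> P y -> walk_in e w P x y H) ->
  exists j l, (forall z, P z -> f j z = l) /\
    exists2 z, P z & d z l <= t%:R * gam.
Proof.
have [c cP] := cluster_colouring.
(* By the colouring at most one cluster of colour [j] contains [z]; if there is none, [z] stays
   put. *)
pose f j z := if pselect (exists l, cluster l z /\ c l = j) is left ex
  then projT1 (cid ex) else z.
have fP j z l : cluster l z -> c l = j -> f j z = l.
  move=> lz lj; rewrite /f; case: pselect => [ex|[]]; last by exists l.
  by case: (cid ex) => /= m [mz mj]; apply: cP mz lz _; rewrite mj.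
exists f; split.
  move=> j z; rewrite /f; case: pselect => [ex|_]; last first.
    by rewrite sp_dist_refl // addr_ge0 // mulr_ge0 // ltW.
  case: (cid ex) => /= l [[x xl xz] _].
  apply: le_trans (sp_dist_triangle wg cg x _ _) _; apply: lerD.
    by rewrite sp_dist_sym //; apply: walk_in_dist xz.
  by rewrite -xl sp_dist_sym //; apply: label_dist.
move=> P x0 Px0 Pw.
(* Walks inside [P] meet no label of rank below that of [x], so all of [P] lies in the cluster of
   [sigma x]. *)
have [x Px xmin] := arg_minnP (fun x => rho (sigma x)) Px0.
exists (c (sigma x)), (sigma x); split; last first.
  by exists x => //; rewrite sp_dist_sym //; apply: label_dist.
move=> z Pz; apply: fP => //; exists x => //.
by apply: walk_in_le (lexx H) (Pw _ _ Px Pz) => y /xmin.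
Qed.

End Chains.

(** * Trees given by parent pointers *)

Lemma acyclic_of_rank (U : finType) (e : rel U) (rho : U -> nat) :
  symmetric e -> (forall x y, e x y -> rho x != rho y) ->
  (forall z a b, e z a -> e z b -> (rho a < rho z)%N -> (rho b < rho z)%N -> a = b) ->
  ~ exists c : seq U, [/\ (3 <= size c)%N, uniq c & cycle e c].
Proof.
move=> es ne one [[|x0 c0] [// sz uc cc]].
(* The vertex of largest rank on a cycle would have two distinct neighbours of smaller rank. *)
have [z zc zmax] : exists2 z, z \in x0 :: c0 & forall y, y \in x0 :: c0 -> (rho y <= rho z)%N.
  have [z zc zP] := arg_maxnP rho (mem_head x0 c0 : [pred y | y \in x0 :: c0] x0).
  by exists z.
have [i c cE] := rot_to zc.
have zmax' y : y \in z :: c -> (rho y <= rho z)%N.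
  by rewrite -cE mem_rot; apply: zmax.
move: sz uc cc; rewrite -(size_rot i) -(rot_uniq i) -(rot_cycle i) cE.
case: c zmax' {cE} => [|a [|b c]] //= zmax' _ /and4P[_ ab _ _].
rewrite rcons_path => /and4P[za _ _ lz].
have lt y : e z y -> y \in [:: z, a, b & c] -> (rho y < rho z)%N.
  by move=> zy yc; rewrite ltn_neqAle zmax' // andbT eq_sym ne.
have zl : e z (last b c) by rewrite es.
have ac : a \in [:: z, a, b & c] by rewrite !inE eqxx orbT.
have lc : last b c \in [:: z, a, b & c] by rewrite !in_cons -in_cons mem_last !orbT.
by move: ab; rewrite (one z a (last b c) za zl (lt a za ac) (lt _ zl lc)) mem_last.
Qed.

Section ParentTree.
Variables (R : realType) (U : finType) (root : U) (par : U -> U) (h : U -> nat).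
Hypothesis par_lt : forall x, x != root -> (h (par x) < h x)%N.
Variable wt : U -> R.
Hypothesis wt0 : forall x, x != root -> 0 < wt x.

Definition parent : rel U := fun x y => (x != root) && (par x == y).
Definition parent_rel : rel U := fun x y => parent x y || parent y x.
Definition parent_w (x y : U) : R := if parent x y then wt x else wt y.

Lemma parent_sym : symmetric parent_rel.
Proof. by move=> x y; rewrite /parent_rel orbC. Qed.

Lemma parent_h x y : parent x y -> (h y < h x)%N.
Proof. by move=> /andP[/par_lt + /eqP <-]. Qed.

Lemma parent_irr : irreflexive parent_rel.
Proof.
move=> x; rewrite /parent_rel orbb; apply/negP => /parent_h; by rewrite ltnn.
Qed.

Lemma parent_connected : connected_graph parent_rel.
Proof.
have cr x : connect parent_rel x root.
  have [m] := ubnP (h x); elim: m x => // m IH x xm.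
  have [->|xr] := eqVneq x root; first exact: connect0.
  apply: (@connect_trans _ _ (par x)).
    by apply: connect1; rewrite /parent_rel /parent xr eqxx.
  by apply: IH; have := par_lt xr; lia.
move=> x y; apply: connect_trans (cr x) _.
by rewrite (sym_connect_sym parent_sym).
Qed.

Lemma parent_tree : is_tree parent_rel.
Proof.
split; [exact: parent_sym | exact: parent_irr | exact: parent_connected |].
apply: (acyclic_of_rank (rho := h)) parent_sym _ _.
  by move=> x y /orP[] /parent_h; [rewrite ltn_neqAle eq_sym | rewrite ltn_neqAle] => /andP[].
have up z a : parent_rel z a -> (h a < h z)%N -> par z = a.
  move=> /orP[/andP[_ /eqP]//|/parent_h]; lia.
by move=> z a b za zb az bz; rewrite -(up z a) // -(up z b).
Qed.

Lemma parent_weighted : weighted_graph parent_rel parent_w.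
Proof.
split; [exact: parent_sym | exact: parent_irr |] => x y.
rewrite /parent_rel /parent_w.
have [xy|] := boolP (parent x y).
  have /negPf-> : ~~ parent y x.
    by apply/negP => /parent_h; have := parent_h xy; lia.
  by case/andP: xy => /wt0.
by move=> _ /= yx; rewrite yx; case/andP: yx => /wt0.
Qed.

Lemma parent_dist x : x != root -> sp_dist parent_rel parent_w x (par x) <= wt x.
Proof.
move=> xr; have xy : parent x (par x) by rewrite /parent xr eqxx.
have -> : wt x = parent_w x (par x) by rewrite /parent_w xy.
by apply: (sp_dist_edge parent_weighted); rewrite /parent_rel xy.
Qed.

(** The map [g] does not stretch tree edges, hence does not stretch tree walks. *)
Lemma parent_dominates (V : finType) (e : rel V) (w : V -> V -> R) (g : U -> V) :
  weighted_graph e w -> connected_graph e ->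
  (forall x, x != root -> sp_dist e w (g x) (g (par x)) <= wt x) ->
  forall x y, sp_dist e w (g x) (g y) <= sp_dist parent_rel parent_w x y.
Proof.
move=> wg cg gP x y; apply: (sp_dist_lb parent_connected) => p.
elim: p x => [|z p IH] x /=; first by move=> _ ->; rewrite sp_dist_refl.
move=> /andP[xz zp] lp; apply: le_trans (sp_dist_triangle wg cg (g z) _ _) _.
apply: lerD (IH _ zp lp); rewrite /parent_w.
move: xz; rewrite /parent_rel; case: ifP => [/andP[xr /eqP <-] _|_ /= /andP[zr /eqP <-]].
  exact: gP.
by rewrite sp_dist_sym //; apply: gP.
Qed.

End ParentTree.

(** * The tree of one sequence of maps *)

Section PointerTree.
Variables (R : realType) (V : finType) (e : rel V) (w : V -> V -> R).
Hypotheses (wg : weighted_graph e w) (cg : connected_graph e).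
Local Notation d := (sp_dist e w).
Variables (f : nat -> V -> V) (B : nat -> R).
Hypothesis fB : forall j z, d z (f j z) <= B j.

Fixpoint climb (i : nat) (z : V) : V := if i is j.+1 then f j (climb j z) else z.

Lemma climb_dist i z : d z (climb i z) <= \sum_(j < i) B j.
Proof.
elim: i => [|i IH]; first by rewrite big_ord0 sp_dist_refl.
rewrite big_ord_recr /=; apply: le_trans (sp_dist_triangle wg cg (climb i z) _ _) _.
exact: lerD.
Qed.

(** Take one copy of [V] per level, with [V] embedded at level 0 and level [j] pointing to level
    [j.+1] by [f j]. Projection to [V] gives domination; [u] and [v] meet at level [i.+1] after
    [i.+1] edges each. *)
Lemma pointer_tree (r : V) (L : nat) (eta : R) : 0 < eta ->
  exists T : wtree R V, dominating_tree d T /\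
    forall i u v, (i < L)%N -> f i (climb i u) = f i (climb i v) ->
    sp_dist (@wt_rel _ _ T) (@wt_w _ _ T) (wt_emb T u) (wt_emb T v) <=
      (\sum_(j < i) B j) *+ 2 + eta *+ (i.+1).*2
      + d (climb i u) (f i (climb i u)) + d (climb i v) (f i (climb i v)).
Proof.
move=> eta0; pose U := ('I_L.+1 * V)%type.
(* Level L carries no pointers: its vertices hang from the one that serves as the root. *)
pose root : U := (ord_max, r).
pose par (x : U) : U := if (x.1 < L)%N then (inord x.1.+1, f x.1 x.2) else root.
(* Doubling the level term leaves room to put [root] strictly below the rest of level [L]. *)
pose h (x : U) : nat := ((L - x.1).*2 + (x.2 != r))%N.
have par_lt x : x != root -> (h (par x) < h x)%N.
  case: x => i z; rewrite /par /h /=; case: (ltnP i L) => iL xr /=.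
    by rewrite inordK //; case: (_ != r); case: (_ != r); lia.
  have iE : i = ord_max by apply: val_inj => /=; have := ltn_ord i; lia.
  have zr : z != r by apply: contraNneq xr => ->; rewrite iE.
  by rewrite zr eqxx iE /= subnn.
(* The summand [eta] keeps the weight positive where a pointer fixes its vertex. *)
pose wt (x : U) : R := d x.2 (par x).2 + eta.
have wt0 x : x != root -> 0 < wt x.
  by move=> _; have := sp_dist_ge0 wg cg x.2 (par x).2; rewrite /wt; lra.
have tw := parent_weighted par_lt wt0.
have tc := parent_connected par_lt.
exists (WTree (parent_rel root par) (parent_w root par wt) (fun z => (ord0, z))).
split.
  split=> /=; first exact: parent_tree par_lt.
  - exact: tw.
  - by move=> x y [].
  move=> x y.
  apply: (parent_dominates par_lt (g := snd) wg cg _ (ord0, x) (ord0, y)).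
  by move=> z _; rewrite /wt lerDl ltW.
move=> i u v iL E /=.
set D := sp_dist _ _.
pose nd j z : U := (inord j, z).
have up j z : (j < L)%N -> D (nd j z) (nd j.+1 (f j z)) <= d z (f j z) + eta.
  move=> jL; have jE : (inord j : 'I_L.+1) = j :> nat by rewrite inordK // ltnS ltnW.
  have pE : par (nd j z) = nd j.+1 (f j z) by rewrite /par /nd /= jE jL.
  have nr : nd j z != root.
    by apply/eqP => -[/(congr1 val) /=]; rewrite jE => jLE; move: jL; rewrite jLE ltnn.
  by have := parent_dist par_lt wt0 nr; rewrite /wt pE.
have ups j z : (j < L)%N -> D (ord0, z) (nd j (climb j z)) <= \sum_(k < j) B k + eta *+ j.
  elim: j => [|j IH] jL.
    have -> : nd 0 z = (ord0, z) by rewrite /nd; congr pair; apply: val_inj; rewrite /= inordK.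
    by rewrite [D _ _](sp_dist_refl tw tc) big_ord0 addr0.
  apply: le_trans (sp_dist_triangle tw tc (nd j (climb j z)) _ _) _.
  have := IH (ltnW jL); have := up j (climb j z) (ltnW jL); have := fB j (climb j z).
  rewrite big_ord_recr /= mulrS; lra.
have half z : D (ord0, z) (nd i.+1 (f i (climb i z))) <=
    \sum_(k < i) B k + eta *+ i.+1 + d (climb i z) (f i (climb i z)).
  apply: le_trans (sp_dist_triangle tw tc (nd i (climb i z)) _ _) _.
  have := ups i z iL; have := up i (climb i z) iL; rewrite mulrS; lra.
apply: le_trans (sp_dist_triangle tw tc (nd i.+1 (f i (climb i u))) _ _) _.
have := half u; have := half v; rewrite -E -/D => hv hu.
rewrite -addnn mulrnDr mulr2n.
have := sp_dist_sym tw tc (nd i.+1 (f i (climb i u))) (ord0, v); rewrite -/D => ->.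
lra.
Qed.

End PointerTree.

(** * Combining the scales *)

Section Multiscale.
Variables (R : realType) (V : finType) (e : rel V) (w : V -> V -> R).
Hypotheses (wg : weighted_graph e w) (cg : connected_graph e).
Local Notation d := (sp_dist e w).

Definition ellipse (u v : V) (a : R) : pred V := [pred z | d u z + d z v < d u v + a].

(** A near-geodesic from [x] to the focus [u] whose error is the slack left at [x] cannot leave the
    ellipse. *)
Lemma ellipse_walk u v a x : ellipse u v a x ->
  walk_in e w (ellipse u v a) x u (d u v + a).
Proof.
move=> Px; have a0 : 0 < d u v + a - d u x - d x v by move: Px; rewrite /ellipse /=; lra.
apply: walk_in_le (near_geodesic wg cg x u a0) => [z|].
  rewrite !inE => hz; have := sp_dist_triangle wg cg x z v.
  rewrite (sp_dist_sym wg cg u z) (sp_dist_sym wg cg z x).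
  rewrite (sp_dist_sym wg cg x u) in hz. lra.
have := sp_dist_ge0 wg cg x v; rewrite (sp_dist_sym wg cg x u); lra.
Qed.

Lemma ellipse_near u v a b x : d u x <= b \/ d v x <= b -> 2 * b < a -> ellipse u v a x.
Proof.
move=> near ba; rewrite /ellipse /=.
have := sp_dist_triangle wg cg u x v; have := sp_dist_triangle wg cg v u x.
rewrite (sp_dist_sym wg cg x u) (sp_dist_sym wg cg x v).
case: near; lra.
Qed.

(** Walk length [3 * D] suffices to join two points of the relevant ellipse through a focus; the
    displacement bound adds at most [D] for the distance to the label. *)
Definition scale_maps (N : nat) (D b : R) (f : 'I_N -> V -> V) : Prop :=
  (forall j z, d z (f j z) <= 4 * D) /\
  forall (P : pred V) (x0 : V), P x0 ->
    (forall x y, P x -> P y -> walk_in e w P x y (3 * D)) ->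
  exists j l, (forall z, P z -> f j z = l) /\ exists2 z, P z & d z l <= b.

Lemma geometric_drift (D : nat -> R) q m i : 0 <= D m -> (0 < q)%N ->
  (forall j, D (m + q * j.+1)%N = D (m + q * j)%N * 2 ^+ q) ->
  (\sum_(j < i) 4 * D (m + q * j)%N) * 2 ^+ q <= 8 * D (m + q * i)%N.
Proof.
move=> D0 q0 DS; have Dn j : 0 <= D (m + q * j)%N.
  elim: j => [|j IH]; first by rewrite muln0 addn0.
  by rewrite DS mulr_ge0 // exprn_ge0.
have q2 : 2 <= 2 ^+ q :> R by rewrite -natrX ler_nat -[leqLHS]expn1 leq_exp2l.
elim: i => [|i IH]; first by rewrite big_ord0 mul0r mulr_ge0.
rewrite big_ord_recr /= mulrDl DS.
by have := ler_wpM2l (Dn i) q2; lra.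
Qed.

(* The spacing factor 2 ^ (E + 9) exceeds 512 * E, which keeps the drift of the pointers of
   all smaller scales below a quarter of D / (16 * E). *)
Lemma multiscale (r : V) (E N : nat) (eps : R) : (0 < E)%N -> 1 <= eps * E%:R ->
  (forall D, 0 < D -> exists f : 'I_N -> V -> V, scale_maps D (D / (16 * E%:R)) f) ->
  exists F : 'I_#|{: 'I_(E + 9) * 'I_N}| -> wtree R V, tree_cover d (1 + eps) F.
Proof.
move=> E0 epsE scale; set q := (E + 9)%N; set kE : R := E%:R.
have kE1 : 1 <= kE by rewrite ler1n.
have [delta delta0 deltaP] := sp_dist_gap wg cg.
pose D m : R := delta * 2 ^+ m.
have D0 m : 0 < D m by rewrite mulr_gt0 // exprn_gt0.
have [g gP] := choice (fun m => scale (D m) (D0 m)).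
have [M MP] := sp_dist_bounded wg cg.
have [L LP] : exists L, M <= D L.
  have M0 : 0 <= M / delta.
    by rewrite divr_ge0 ?(ltW delta0) // (le_trans (sp_dist_ge0 wg cg r r)).
  exists (Num.bound (M / delta)); rewrite /D [leRHS]mulrC -ler_pdivrMr //.
  apply: (le_trans (ltW (archi_boundP M0))).
  by rewrite -natrX ler_nat ltnW // ltn_expl.
(* At most [L.+1] edges are climbed on either side, so the terms [eta] add up to at most [2 * e1] at
   every scale. *)
pose eta : R := delta / (16 * kE * L.+1%:R).
have eta0 : 0 < eta by rewrite divr_gt0 // !mulr_gt0 // ?ltr0n //; lra.
pose f (sj : 'I_q * 'I_N) i := g (sj.1 + q * i)%N sj.2.
pose B (sj : 'I_q * 'I_N) i : R := 4 * D (sj.1 + q * i)%N.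
have fB sj i z : d z (f sj i z) <= B sj i by case: (gP (sj.1 + q * i)%N) => + _; apply.
have [T TP] := choice (fun sj => pointer_tree wg cg (fB sj) r L.+1 eta0).
exists (fun k => T (enum_val k)); split; first by move=> k; case: (TP (enum_val k)).
move=> u v uv.
have ex_m : exists m, d u v <= D m by exists L; apply: le_trans LP.
case: (ex_minnP ex_m) => m dm mmin.
have md : D m < 2 * d u v.
  case: m dm mmin => [|m] dm mmin.
    by rewrite /D mulr1; have := deltaP _ _ uv; lra.
  have : ~~ (d u v <= D m) by apply/negP => /mmin; rewrite ltnn.
  by rewrite -ltNge /D exprS mulrCA; lra.
have mL : (m <= L)%N by apply: mmin; apply: le_trans LP.
have q0 : (0 < q)%N by rewrite addn_gt0 orbT.
pose s : 'I_q := Ordinal (ltn_pmod m q0).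
set i := (m %/ q)%N; have mE : (s + q * i)%N = m.
  by rewrite /= addnC mulnC -divn_eq.
have iL : (i <= L)%N by apply: leq_trans (leq_div _ _) mL.
pose e1 := D m / (16 * kE).
have DE : D m = 16 * kE * e1 by rewrite mulrC divfK // mulf_neq0 //; lra.
have e10 : 0 < e1 by rewrite divr_gt0 //; lra.
have e1D : 16 * e1 <= D m by rewrite DE -mulrA ler_pM2l // ler_peMl // ltW.
have [j [l [jl [z Pz zl]]]] : exists j l, (forall z, ellipse u v (2 * e1) z -> g m j z = l) /\
    exists2 z, ellipse u v (2 * e1) z & d z l <= e1.
  have [_ H] := gP m; apply: (H _ u) => [|x y Px Py].
    by apply: (@ellipse_near _ _ _ 0); [left; rewrite sp_dist_refl | lra].
  apply: walk_in_le (walk_in_trans (ellipse_walk Px) (walk_in_sym wg (ellipse_walk Py))) => //.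
  lra.
pose sj := (s, j); pose S := \sum_(h < i) B sj h.
have S_le : 4 * S <= e1.
  have := @geometric_drift D q s i (ltW (D0 _)) q0 _; rewrite -/S mE => H.
  have {}H : S * 2 ^+ q <= 8 * D m.
    by apply: H => h; rewrite /D mulnS addnCA exprD [2 ^+ q * _]mulrC mulrA.
  have S0 : 0 <= S by apply: sumr_ge0 => h _; rewrite mulr_ge0 // ltW.
  have q512 : 512 * kE <= 2 ^+ q.
    rewrite /q exprD mulrC ler_pM ?ler0n // -natrX ler_nat //.
    by rewrite ltnW // ltn_expl.
  have := ler_wpM2l S0 q512 => H2.
  have : kE * (512 * S) <= kE * (128 * e1) by move: H H2; rewrite DE; lra.
  by rewrite ler_pM2l; lra.
(* The drift [S] is at most [e1 / 4], so the climbed images of both foci stay in the ellipse of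
   slack [2 * e1]. *)
have near x : d x (climb (f sj) i x) <= S := climb_dist wg cg (fB sj) i x.
have fi a : ellipse u v (2 * e1) a -> f sj i a = l by move=> /jl; rewrite /f mE.
have cu : f sj i (climb (f sj) i u) = l.
  by apply/fi/(@ellipse_near _ _ _ S); [left; apply: near | lra].
have cv : f sj i (climb (f sj) i v) = l.
  by apply/fi/(@ellipse_near _ _ _ S); [right; apply: near | lra].
have [_ /(_ i u v)] := TP sj; rewrite cu cv => /(_ iL erefl) bound.
exists (enum_rank sj); rewrite enum_rankK; apply: le_trans bound _.
(* Excess over [d u v]: four drifts [S], [2 * e1] from the terms [eta], [2 * e1] for the detour from
   [z] to [l] and back, and [2 * e1] because [z] is only in the ellipse; at most [7 * e1] in all. *)
rewrite -/S.
have eta_le : eta *+ (i.+1).*2 <= 2 * e1.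
  apply: (@le_trans _ _ (eta *+ (L.+1).*2)); first by rewrite ler_wpMn2l ?(ltW eta0) // leq_double.
  have -> : eta *+ (L.+1).*2 = 2 * (delta / (16 * kE)).
    rewrite -[eta *+ _]mulr_natr -mul2n natrM /eta.
    have n0 : L.+1%:R != 0 :> R by rewrite pnatr_eq0.
    have k0 : kE != 0 by rewrite pnatr_eq0 -lt0n.
    have cancel (a b c : R) : b != 0 -> c != 0 -> a / (16 * b * c) * (2 * c) = 2 * (a / (16 * b)).
      by move=> b0 c0; field; rewrite b0 c0.
    exact: cancel.
  rewrite ler_pM2l // ler_pM2r ?invr_gt0; last lra.
  by rewrite ler_peMr ?(ltW delta0) // exprn_ege1 // ler1n.
have eps_e1 : 8 * e1 <= eps * d u v.
  have eps0 : 0 < eps by rewrite -(pmulr_lgt0 _ (lt_le_trans ltr01 kE1)) (lt_le_trans ltr01).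
  have h1 : e1 <= eps * kE * e1 by rewrite ler_peMl // ltW.
  have h2 : 8 * (kE * e1) <= d u v by move: md; rewrite DE; lra.
  by have := ler_wpM2l (ltW eps0) h2; lra.
have tu := sp_dist_triangle wg cg u (climb (f sj) i u) l.
have tv := sp_dist_triangle wg cg v (climb (f sj) i v) l.
have zu := sp_dist_triangle wg cg z u l; have zv := sp_dist_triangle wg cg z v l.
move: Pz (near u) (near v); rewrite /ellipse /=.
rewrite (sp_dist_sym wg cg _ u) in tu; rewrite (sp_dist_sym wg cg _ v) in tv.
rewrite (sp_dist_sym wg cg z v); lra.
Qed.

End Multiscale.

(** * Rooted trees and the rank given by a tree decomposition *)

Section RootedTree.
Variables (B : finType) (eB : rel B) (r : B).
Hypothesis tB : is_tree eB.

Let sB : symmetric eB. Proof. by case: tB. Qed.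

(** The dominator relation from [r]; in a tree it says that [c] belongs to the subtree rooted at
    [b]. *)
Definition below (b c : B) : bool :=
  `[< forall p, path eB r p -> last r p = c -> b \in r :: p >].

Definition depth (c : B) : nat := #|[set b | below b c]|.

Lemma not_belowP b c : ~~ below b c ->
  exists p, [/\ path eB r p, last r p = c & b \notin r :: p].
Proof.
move=> /asboolPn; rewrite -existsNE => -[p /not_implyP[rp /not_implyP[pc /negP bp]]].
by exists p.
Qed.

Lemma below_refl b : below b b.
Proof. by apply/asboolP => p _ <-; apply: mem_last. Qed.

Lemma below_root c : below r c.
Proof. by apply/asboolP => p _ _; apply: mem_head. Qed.

Lemma below_trans a b c : below a b -> below b c -> below a c.
Proof.
move=> /asboolP ab /asboolP bc; apply/asboolP => p rp pc.
have bp := bc p rp pc; case/splitPl: bp rp {pc} => p1 p2 p1b rp.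
move: rp; rewrite cat_path => /andP[rp1 _].
by rewrite -cat_cons mem_cat ab.
Qed.

(** Extending a walk to [c'] that avoids [b] by the edge back to [c] gives a walk that can meet [b]
    only at its end. *)
Lemma below_cross b c c' : eB c c' -> below b c -> ~~ below b c' -> c = b.
Proof.
move=> cc' /asboolP bc /not_belowP[p [rp pc bp]].
have := bc (rcons p c); rewrite rcons_path rp pc sB cc' last_rcons => /(_ erefl erefl).
by rewrite -rcons_cons mem_rcons in_cons (negPf bp) orbF => /eqP.
Qed.

(** Both neighbours are joined to [r] by walks avoiding [b]; a simple path between them that avoids
    [b] would close a cycle through [b]. *)
Lemma upper_neighbour_unique b a a' : eB b a -> eB b a' ->
  ~~ below b a -> ~~ below b a' -> a = a'.
Proof.
move=> ba ba' /not_belowP[p [rp pa bp]] /not_belowP[p' [rp' pa' bp']].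
pose e' := [rel x y | [&& eB x y, x != b & y != b]].
have e'_sym : connect_sym e'.
  by apply: sym_connect_sym => x y; rewrite /= sB [(x != b) && _]andbC.
have conn q : path eB r q -> b \notin r :: q -> connect e' r (last r q).
  elim/last_ind: q => // q y IH; rewrite rcons_path -rcons_cons mem_rcons in_cons negb_or.
  move=> /andP[rq qy] /andP[yb bq]; rewrite last_rcons.
  apply: connect_trans (IH rq bq) (connect1 _); rewrite /= qy [y == b]eq_sym yb andbT /=.
  by apply: contra bq => /eqP <-; apply: mem_last.
have ra := conn p rp bp; have ra' := conn p' rp' bp'; rewrite pa in ra; rewrite pa' in ra'.
have : connect e' a a' by apply: connect_trans ra'; rewrite e'_sym.
move=> /connectP[q aq a'E]; case/shortenP: aq a'E => {}q aq uq _ a'E.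
have [_ _ _ acyc] := tB; case: q aq uq a'E => [//|y q] aq uq a'E.
have path_b x s : path e' x s -> (b \notin s) && path eB x s.
  elim: s x => //= z s IH x /andP[/and3P[xz _ zb] /IH /andP[bs zs]].
  by rewrite in_cons negb_or eq_sym zb bs xz.
have /andP[bq eq] := path_b _ _ aq.
case: acyc; exists [:: b, a, y & q]; split=> //.
  rewrite /= in uq *; rewrite uq andbT in_cons negb_or bq andbT.
  by apply: contra bp => /eqP ->; rewrite -pa mem_last.
rewrite /= in a'E eq *; case/andP: eq => -> eq.
by rewrite ba rcons_path eq -a'E sB ba'.
Qed.

Lemma simple_walk c : exists p, [/\ path eB r p, last r p = c & uniq (r :: p)].
Proof.
have [_ _ cB _] := tB; have /connectP[p rp pc] := cB r c.
by case/shortenP: rp pc => q rq uq _ qc; exists q.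
Qed.

Lemma below_anti a b : below a b -> below b a -> a = b.
Proof.
move=> /asboolP ab /asboolP ba; have [p [rp pb]] := simple_walk b.
have ap := ab p rp pb; case/splitPl: ap rp pb => p1 p2 p1a.
rewrite cat_path last_cat p1a => /andP[rp1 _].
have {}ba := ba p1 rp1 p1a; case: p2 => [//|y p2] pb.
have bp2 : b \in y :: p2 by rewrite -pb /= mem_last.
by rewrite -cat_cons cat_uniq => /and3P[_ /hasPn/(_ b bp2) + _]; rewrite ba.
Qed.

Lemma depth_eq a c : below a c -> (depth c <= depth a)%N -> a = c.
Proof.
move=> ac le; apply: (below_anti ac).
have sub : [set b | below b a] \subset [set b | below b c].
  by apply/subsetP => b; rewrite !inE => ba; apply: below_trans ba ac.
have /eqP E : [set b | below b a] == [set b | below b c] by rewrite eqEcard sub.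
have : c \in [set b | below b a] by rewrite E inE below_refl.
by rewrite inE.
Qed.

(** A simple walk from [r] to [b] enters [b] from its unique upper neighbour, so it passes through
    [c]. *)
Lemma depth_lt b c : eB b c -> ~~ below b c -> (depth c < depth b)%N.
Proof.
move=> bc nbc; have [E|ne] := leqP (depth b) (depth c); last by [].
have cb : below c b.
  apply/asboolP => p rp pb; case/shortenP: rp (esym pb) => p' rp' up' sp' p'b.
  case/lastP: p' => [|p' y] in rp' up' sp' p'b.
    by move: nbc; rewrite p'b below_root.
  move: p'b rp' up' sp'; rewrite last_rcons => <-.
  rewrite rcons_path -rcons_cons rcons_uniq => /andP[rp' yb] /andP[bp' _] sp'.
  have -> : c = last r p'.
    apply: upper_neighbour_unique bc _ nbc _; first by rewrite sB.
    apply/negP => /asboolP /(_ _ rp' erefl); exact/negP.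
  have := mem_last r p'; rewrite !in_cons => /predU1P[->|lp']; first by rewrite eqxx.
  by rewrite sp' ?orbT // mem_rcons in_cons lp' orbT.
by move: nbc; rewrite -(depth_eq cb E) below_refl.
Qed.

End RootedTree.

(** All bags meeting the branch of [z] lie in the subtree of the top bag [b] of [z]. A vertex of
    [lower z] shares such a bag; if it missed [bag b], its own top bag would lie strictly inside
    that subtree, against its smaller rank. So [lower z] is contained in [bag b] minus [z]. *)
Lemma decomposition_order (V B : finType) (e : rel V) (eB : rel B) (bag : B -> {set V})
    (t : nat) (x0 : V) :
  tree_decomposition e eB bag -> (forall b, #|bag b| <= t.+1)%N ->
  exists2 rho : V -> nat, injective rho & forall z, (#|lower e rho z| <= t)%N.
Proof.
move=> [tB cov cove conn] bagt; have [r _] := cov x0.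
pose dep := depth eB r.
have /choice[top topP] : forall v, exists b, v \in bag b /\
    forall c, v \in bag c -> (dep b <= dep c)%N.
  move=> v; have [b vb] := cov v.
  by have [c vc cP] := @arg_minnP _ b (fun b => v \in bag b) dep vb; exists c.
(* A walk through bags of [v] leaves the subtree only by stepping from [b] to a bag of smaller
   depth; either alternative forbids this. *)
have stays v b b1 b2 : v \in bag b1 -> v \in bag b2 -> below eB r b b1 ->
    v \notin bag b \/ (forall c, v \in bag c -> dep b <= dep c)%N -> below eB r b b2.
  move=> vb1 vb2; have [p [+ + ]] := conn _ _ _ vb1 vb2.
  elim: p b1 vb1 => [|y p IH] b1 vb1 /=; first by move=> _ -> .
  move=> /andP[by1 yp] yb2 /andP[vy vp] bb1 vb; apply: (IH y) => //.
  apply: contraT => nby; have b1E := below_cross tB by1 bb1 nby.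
  case: vb => [|/(_ y vy)]; first by rewrite -b1E vb1.
  by rewrite leqNgt (depth_lt tB _ nby) // -b1E.
(* Depth decides first; the enumeration breaks ties. *)
pose rho v := (dep (top v) * #|V| + enum_rank v)%N.
have V0 : (0 < #|V|)%N by apply/card_gt0P; exists x0.
have rho_dep x y : (rho x <= rho y)%N -> (dep (top x) <= dep (top y))%N.
  by move=> /(leq_div2r #|V|); rewrite !divnMDl // !divn_small ?addn0.
exists rho.
  move=> x y /(congr1 (modn^~ #|V|)); rewrite !modnMDl !modn_small //.
  by move=> /val_inj/enum_rank_inj.
move=> z; set b := top z.
have inv_step x y : (forall c, x \in bag c -> below eB r b c) -> e x y ->
    (rho z <= rho y)%N -> forall c, y \in bag c -> below eB r b c.
  move=> xP /cove[c /andP[xc yc]] zy c' yc'.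
  apply: stays yc yc' (xP c xc) _; right => a /(proj2 (topP y)).
  exact/leq_trans/rho_dep.
have inv x : branch e rho z x -> forall c, x \in bag c -> below eB r b c.
  move=> /connectP[p]; elim/last_ind: p x => [|p y IH] x.
    move=> _ -> c zc; apply: stays (proj1 (topP z)) zc (below_refl _ _ _) _.
    by right; case: (topP z).
  rewrite rcons_path last_rcons => /andP[zp /and3P[py _ zy]] ->.
  by apply: inv_step py zy; apply: IH zp erefl.
have sub : lower e rho z \subset bag b :\ z.
  apply/subsetP => s; rewrite inE => /andP[sz /existsP[x /andP[zx xs]]].
  rewrite in_setD1; apply/andP; split; first by apply: contraTneq sz => ->; rewrite ltnn.
  apply: contraT => nsb; have /cove[c /andP[xc sc]] := xs.
  have [st _] := topP s.
  have bs := stays s b c (top s) sc st (inv x zx c xc) (or_introl nsb).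
  by move: st; rewrite -(depth_eq tB bs (rho_dep _ _ (ltnW sz))) (negPf nsb).
apply: leq_trans (subset_leq_card sub) _.
by have := bagt b; rewrite (cardsD1 z) (proj1 (topP z)).
Qed.

(** * Choice of parameters and the size bound *)

Section Assembly.
Variables (R : realType) (V : finType) (e : rel V) (w : V -> V -> R).
Hypotheses (wg : weighted_graph e w) (cg : connected_graph e).
Local Notation d := (sp_dist e w).
Variables (rho : V -> nat) (rho_inj : injective rho).

(** A neighbour of [z] of smaller rank belongs to [lower z], so [rho] meets the acyclicity
    criterion. *)
Lemma lower_card1_tree : (forall z, #|lower e rho z| <= 1)%N -> is_tree e.
Proof.
have [es ei _] := wg; move=> card1; split=> //.
apply: (acyclic_of_rank (rho := rho)) es _ _.
  by move=> x y xy; apply: contraTneq xy => /rho_inj ->; rewrite ei.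
move=> z a b za zb az bz; have /card_le1_eqP one := card1 z.
have al : a \in lower e rho z by apply: lowerI za az; apply: branch_refl.
have bl : b \in lower e rho z by apply: lowerI zb bz; apply: branch_refl.
exact: one bl al.
Qed.

Lemma scale_maps_exist (t E : nat) (D : R) : (forall z, #|lower e rho z| <= t)%N ->
  (0 < t)%N -> (0 < E)%N -> 0 < D ->
  exists f : 'I_(t.+1 ^ (t + 288 * E * t).+1) -> V -> V,
    scale_maps e w D (D / (16 * E%:R)) f.
Proof.
move=> lower_card t0 E0 D0.
have tR : 1 <= t%:R :> R by rewrite ler1n.
have ER : 1 <= E%:R :> R by rewrite ler1n.
(* Chosen so that the label distance [t * gam] equals the allowed error [D / (16 * E)]; then
   [18 * D = 288 * E * t * gam]. *)
pose gam : R := D / (16 * E%:R * t%:R).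
have gam0 : 0 < gam by rewrite divr_gt0 // !mulr_gt0 //; lra.
have tgam : t%:R * gam = D / (16 * E%:R).
  by rewrite /gam; field; rewrite !gt_eqF //; lra.
have DE : D / (16 * E%:R) <= D by rewrite ler_pdivrMr ?ler_peMr ?mulr_gt0 //; lra.
have K6 : 6 * (3 * D) <= (288 * E * t)%:R * gam.
  rewrite !natrM -mulrA tgam le_eqVlt; apply/orP; left; apply/eqP.
  by field; rewrite gt_eqF //; lra.
have [es _ _] := wg.
have [sigma sigmaP] := labelling_exists e d gam rho.
have H0 : 0 <= 3 * D by rewrite mulr_ge0 // ltW.
have [f [f1 f2]] := single_scale wg cg rho_inj gam0 lower_card sigmaP H0 K6.
exists f; split; last by move: f2; rewrite tgam.
by move=> j z; apply: le_trans (f1 j z) _; rewrite tgam; lra.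
Qed.

End Assembly.

(** With [a = t / eps] the binary exponent is quadratic in [a], below [2 ^ 10 * a ^ 2 <= a ^ 12];
    [t >= 2] gives both [a >= 2] and [12 <= 6 * t]. *)
Lemma cover_size (R : realType) (t E : nat) (eps : R) : (2 <= t)%N -> 0 < eps < 1 ->
  E%:R <= 2 / eps ->
  ((E + 9) * t.+1 ^ (t + 288 * E * t).+1)%:R <= powR 2 (powR (t%:R / eps) (6 * t%:R)) :> R.
Proof.
move=> t2 /andP[e0 e1] Ele.
have t2R : 2 <= t%:R :> R by rewrite ler_nat.
set a := t%:R / eps.
have ta : t%:R <= a by rewrite /a ler_pdivlMr // ler_piMr //; lra.
have a2 : 2 <= a by apply: le_trans ta.
have Eta : E%:R * t%:R <= 2 * a.
  apply: (@le_trans _ _ (2 / eps * t%:R)); first by rewrite ler_wpM2r.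
  by rewrite /a mulrAC mulrA.
have Ea : E%:R <= a.
  by have : 0 <= E%:R * (t%:R - 2) :> R by [rewrite mulr_ge0 // subr_ge0]; lra.
pose X := ((E + 9) + t * (t + 288 * E * t).+1)%N.
have kX : ((E + 9) * t.+1 ^ (t + 288 * E * t).+1 <= 2 ^ X)%N.
  rewrite expnD expnM leq_mul //; first by rewrite ltnW // ltn_expl.
  by rewrite leq_exp2r // ltn_expl.
have Xa : X%:R <= a ^+ 12.
  have -> : X%:R = E%:R + 9 + t%:R * (t%:R + 288 * (E%:R * t%:R) + 1) :> R.
    by rewrite /X -addn1 !(natrD, natrM); ring.
  apply: (@le_trans _ _ (a + 9 + a * (a + 288 * (2 * a) + 1))).
    apply: lerD; first lra.
    apply: ler_pM; [lra | | lra | lra].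
    have : 0 <= E%:R * t%:R :> R by rewrite mulr_ge0.
    lra.
  have aa : 4 <= a ^+ 2 by rewrite expr2; nra.
  apply: (@le_trans _ _ (2 ^+ 10 * a ^+ 2)).
    have : 2 * a <= a ^+ 2 by rewrite expr2; nra.
    rewrite !expr2 in aa *; lra.
  rewrite -[12%N]/(10 + 2)%N exprD ler_wpM2r //; first lra.
  by apply: lerXn2r; rewrite ?nnegrE //; lra.
apply: (@le_trans _ _ (powR 2 X%:R)).
  by rewrite powR_mulrn // -natrX ler_nat.
apply: ler_powR; first by rewrite ler1n.
apply: le_trans Xa _; rewrite -powR_mulrn; last lra.
apply: ler_powR; first lra.
by rewrite -[12%:R]/(6 * 2)%:R natrM; lra.
Qed.

Theorem theorem1p3 (R : realType) :
  exists c : R, 0 < c /\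
  forall (V : finType) (e : rel V) (w : V -> V -> R) (t : nat) (eps : R),
    weighted_graph e w -> connected_graph e -> treewidth e t ->
    0 < eps < 1 ->
    exists (k : nat) (F : 'I_k -> wtree R V),
      tree_cover (sp_dist e w) (1 + eps) F /\
      (k%:R <= powR 2 (powR (t%:R / eps) (c * t%:R))).
Proof.
exists 6; split=> // V e w t eps wg cg [[B [eB [bag [td wt]]]] _] eps01.
have [e0 e1] := andP eps01.
have [x0 _|V0] := pickP {: V}; last first.
  (* The empty graph is covered by no tree at all. *)
  exists 0%N, (fun i : 'I_0 => WTree e w id); split; last exact: powR_ge0.
  by split=> [[]//|x]; have := V0 x.
have bagt b : (#|bag b| <= t.+1)%N.
  rewrite -wt (leq_trans _ (leqSpred _)) //.
  exact: (leq_bigmax (F := fun b => #|bag b|) b).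
have [rho rho_inj lower_card] := decomposition_order x0 td bagt.
have [t2|t1] := ltnP 1 t; last first.
  have tree : is_tree e.
    by apply: (lower_card1_tree wg cg rho_inj) => z; apply: leq_trans (lower_card z) t1.
  exists 1%N, (fun i : 'I_1 => WTree e w id); split.
    split=> [i|x y _]; first by split.
    exists ord0 => /=; rewrite ler_peMl ?sp_dist_ge0 //; lra.
  by rewrite -[leLHS](powRr0 2) ler_powR ?powR_ge0 // ler1n.
(* An integer above [1 / eps] and, since [eps < 1], at most [2 / eps]. *)
pose E := (Num.trunc eps^-1).+1.
have epsE : 1 <= eps * E%:R.
  by rewrite -ler_pdivrMl // mulr1 ltW // truncnS_gt.
have E2 : E%:R <= 2 / eps.
  have inv1 : 1 <= eps^-1 by rewrite invf_ge1 // ltW.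
  have : (Num.trunc eps^-1)%:R <= eps^-1 by rewrite truncn_le; lra.
  by rewrite /E -natr1; lra.
have E0 : (0 < E)%N by [].
have scale D := @scale_maps_exist R V e w wg cg rho rho_inj t E D lower_card (ltnW t2) E0.
have [F FP] := multiscale wg cg x0 E0 epsE scale.
exists _, F; split=> //; rewrite card_prod !card_ord.
exact: cover_size.
Qed.
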